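(* Let $g : \mathbb{N}^* \to \mathbb{C}$ be an arithmetic function and let $f : \mathbb{N}^* \to \mathbb{C}$ be the arithmetic function such that $f(n) = \sum_{d \mid n} g(d)$ for all $n \in \mathbb{N}^*$, the sum being over the positive divisors $d$ of $n$. Then $$\forall n \in \mathbb{N}^*, \quad f(n) = \sum_{k=1}^n \mu\left(\frac{k}{(n,k)}\right) \frac{\varphi(k)}{\varphi\left(\frac{k}{(n,k)}\right)} \sum_{l=1}^{\left\lfloor \frac{n}{k} \right\rfloor} \frac{g(kl)}{kl}.$$
   Context: $\mathbb{N}^*$ denotes the set of positive integers. An arithmetic function is any function $\mathbb{N}^* \to \mathbb{C}$. $\varphi$ is Euler's totient function, $\mu$ is the Möbius function, $(n,k)$ denotes the greatest common divisor of $n$ and $k$, and $\lfloor x \rfloor$ denotes the integer part (floor) of $x$. *)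

(* Defs.v *)
From HB Require Import structures.
From mathcomp Require Import all_boot all_order all_algebra.

Set Implicit Arguments.
Unset Strict Implicit.
Unset Printing Implicit Defensive.

Import GRing.Theory.
Local Open Scope ring_scope.

(* For n > 0 the test says that n is squarefree, and then size (primes n) is  *)
(* the number of its prime factors. At 0, where primes 0 = [::], the value is *)
(* junk.                                                                      *)
Definition moebius (n : nat) : int :=
  if all (fun p => logn p n == 1%N) (primes n)
  then (-1) ^+ size (primes n) else 0.

(* Main.v *)
Require Import Defs.
From HB Require Import structures.
From mathcomp Require Import all_boot all_order all_algebra.
From mathcomp Require Import reals.
From mathcomp Require Import complex.
From mathcomp Require Import ring.

Set Implicit Arguments.
Unset Strict Implicit.
Unset Printing Implicit Defensive.

Import Order.TTheory GRing.Theory Num.Theory.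
Local Open Scope ring_scope.
Local Open Scope complex_scope.

(** For fixed [n], the coefficient
    [c k = moebius (k / (n, k)) * totient k / totient (k / (n, k))] is
    Hölder's closed form of the Ramanujan sum of order [k] at [n]. Collecting
    the terms of the double sum with the same product [m = k * l] turns the
    right-hand side into the sum over [1 <= m <= n] of
    [g m / m * \sum_(k | m) c k], so everything rests on the orthogonality
    relation: [\sum_(k | m) c k] is [m] when [m] divides [n], and [0] otherwise
    ([sum_divisors_ramanujan]). Then only the divisors [m] of [n] survive, each
    with weight [g m / m * m = g m], which leaves [f n].

    The closed form lends itself to a proof of the orthogonality relation
    without roots of unity. Both sides are multiplicative in [m], because [c] is
    ([ramanujanM]), so it suffices to treat [m = p ^ e]. With [v = logn p n],
    the values [c (p ^ i)] are [totient (p ^ i)] for [i <= v], then [- p ^ v]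
    for [i = v + 1], then [0]: the partial sums are [p ^ e] up to [e = v], and
    the next term brings them to [0] for good. *)

(** * Divisors and multiplicativity *)

Lemma gcdnM_coprime n a b : coprime a b ->
  gcdn n (a * b) = (gcdn n a * gcdn n b)%N.
Proof.
move=> co_ab; apply/eqP; rewrite eqn_dvd; apply/andP; split.
  rewrite muln_gcdr !muln_gcdl !dvdn_gcd dvdn_gcdr.
  have gcd_n : (gcdn n (a * b) %| n)%N := dvdn_gcdl _ _.
  by rewrite (dvdn_mull n gcd_n) (dvdn_mull a gcd_n) (dvdn_mulr b gcd_n).
rewrite Gauss_dvd; last first.
  exact: coprime_dvdl (dvdn_gcdr _ _) (coprime_dvdr (dvdn_gcdr _ _) co_ab).
rewrite !dvdn_gcd !dvdn_gcdl /=.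
by rewrite dvdn_mulr ?dvdn_gcdr // dvdn_mull ?dvdn_gcdr.
Qed.

Lemma nat_coprime_ind (P : nat -> Prop) :
    (forall p e, prime p -> P (p ^ e)%N) ->
    (forall a b, (0 < a)%N -> (0 < b)%N -> coprime a b ->
       P a -> P b -> P (a * b)%N) ->
  forall n, (0 < n)%N -> P n.
Proof.
move=> Pp PM; elim/ltn_ind=> n IHn n_gt0.
have [n_le1|n_gt1] := leqP n 1.
  by have -> : n = (2 ^ 0)%N; [case: n n_gt0 n_le1 {IHn} => [|[|]] | apply: Pp].
have p_pr := pdiv_prime n_gt1; set p := pdiv n in p_pr.
have [m co_pm def_n] := pfactor_coprime p_pr n_gt0.
have v_gt0 : (0 < logn p n)%N by rewrite logn_gt0 mem_primes p_pr n_gt0 pdiv_dvd.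
have m_gt0 : (0 < m)%N by move: n_gt0; rewrite {1}def_n muln_gt0; case/andP.
have pv_gt1 : (1 < p ^ logn p n)%N.
  by rewrite -(exp1n (logn p n)) ltn_exp2r ?prime_gt1.
rewrite def_n; apply: PM => //.
- by rewrite coprime_sym coprimeXl.
- by apply: IHn => //; rewrite def_n ltn_Pmulr.
- exact: Pp.
Qed.

(** A divisor [d] of [a * b] is recovered as [gcdn d a * gcdn d b]. *)
Lemma divisorsM a b : (0 < a)%N -> (0 < b)%N -> coprime a b ->
  perm_eq (divisors (a * b))
          [seq (x * y)%N | x <- divisors a, y <- divisors b].
Proof.
move=> a_gt0 b_gt0 co_ab; apply: uniq_perm; first exact: divisors_uniq.
  apply: allpairs_uniq; rewrite ?divisors_uniq //.
  have gcdK x y : (x, y) \in [seq (x, y) | x <- divisors a, y <- divisors b] ->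
      gcdn (x * y) a = x /\ gcdn (x * y) b = y.
    case/allpairsP=> -[x' y'] /= [x'a y'b [-> ->]].
    move: x'a y'b; rewrite -!dvdn_divisors // => x'a y'b.
    split; last rewrite mulnC; rewrite gcdnC.
      rewrite mulnC Gauss_gcdr ?(coprime_dvdr y'b) //.
      by rewrite gcdnC; apply/gcdn_idPl.
    rewrite mulnC Gauss_gcdr; first by rewrite gcdnC; apply/gcdn_idPl.
    by rewrite coprime_sym (coprime_dvdl x'a).
  move=> [x y] [x' y'] /gcdK[xE yE] /gcdK[x'E y'E] /= eq_xy.
  rewrite eq_xy in xE yE.
  by rewrite -xE -yE x'E y'E.
move=> d; rewrite -dvdn_divisors ?muln_gt0 ?a_gt0 //.
apply/idP/allpairsP=> [d_ab|[[x y] /= [xa yb ->]]].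
  exists (gcdn d a, gcdn d b); rewrite /= -!dvdn_divisors // !dvdn_gcdr.
  by rewrite -gcdnM_coprime //; split=> //; apply/esym/gcdn_idPl.
by rewrite dvdn_mul // dvdn_divisors.
Qed.

Lemma divisors_pfactor p e : prime p ->
  perm_eq (divisors (p ^ e)) [seq (p ^ i)%N | i <- index_iota 0 e.+1].
Proof.
move=> p_pr; apply: uniq_perm; first exact: divisors_uniq.
  by rewrite map_inj_uniq ?iota_uniq //; apply/expnI/prime_gt1.
move=> d; rewrite -dvdn_divisors ?expn_gt0 ?prime_gt0 //.
apply/(dvdn_pfactor _ _ p_pr)/mapP=> -[i le_ie ->]; exists i => //.
  by rewrite mem_index_iota.
by rewrite mem_index_iota in le_ie.
Qed.

Lemma sum_divisorsE (V : nmodType) (N m : nat) (G : nat -> V) :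
    (0 < m)%N -> (m <= N)%N ->
  \sum_(d <- divisors m) G d = \sum_(1 <= d < N.+1 | (d %| m)%N) G d.
Proof.
move=> m_gt0 le_mN; rewrite -[RHS]big_filter; apply/perm_big/uniq_perm.
- exact: divisors_uniq.
- by rewrite filter_uniq ?iota_uniq.
move=> d; rewrite mem_filter mem_index_iota -dvdn_divisors //.
case: (boolP (d %| m)%N) => // d_m; rewrite (dvdn_gt0 m_gt0 d_m) ltnS.
by rewrite (leq_trans (dvdn_leq m_gt0 d_m)).
Qed.

Lemma sum_multiplesE (V : nmodType) (n k : nat) (G : nat -> V) : (0 < k)%N ->
  \sum_(1 <= l < (n %/ k).+1) G (k * l)%N
    = \sum_(1 <= m < n.+1 | (k %| m)%N) G m.
Proof.
move=> k_gt0; rewrite -[RHS]big_filter -(big_map (muln k) xpredT G).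
apply/perm_big/uniq_perm.
- rewrite map_inj_uniq ?iota_uniq // => x y /eqP.
  by rewrite eqn_pmul2l // => /eqP.
- by rewrite filter_uniq ?iota_uniq.
move=> m; rewrite mem_filter mem_index_iota.
apply/mapP/idP=> [[l]|/and3P[/dvdnP[l ->]]].
  rewrite mem_index_iota !ltnS leq_divRL // mulnC => /andP[l_gt0 le_n] ->.
  by rewrite dvdn_mulr //= muln_gt0 k_gt0 l_gt0 le_n.
rewrite muln_gt0 ltnS => /andP[l_gt0 _] le_n; exists l; last exact: mulnC.
by rewrite mem_index_iota l_gt0 ltnS leq_divRL.
Qed.

(** * The Möbius function *)

Lemma moebius_prime p : prime p -> moebius p = -1.
Proof.
by move=> p_pr; rewrite /moebius primes_prime //= logn_prime ?eqxx ?expr1.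
Qed.

Lemma moebius_pfactor_gt1 p e : prime p -> (1 < e)%N -> moebius (p ^ e) = 0.
Proof.
move=> p_pr e_gt1; rewrite /moebius primesX ?(ltnW e_gt1) // primes_prime //=.
by rewrite pfactorK // gtn_eqF.
Qed.

Lemma moebiusM a b : (0 < a)%N -> (0 < b)%N -> coprime a b ->
  moebius (a * b) = moebius a * moebius b.
Proof.
move=> a_gt0 b_gt0 co_ab.
have primes_ab : perm_eq (primes (a * b)) (primes a ++ primes b).
  apply: uniq_perm; rewrite ?primes_uniq //.
    by rewrite cat_uniq !primes_uniq -coprime_has_primes ?co_ab.
  by move=> p; rewrite mem_cat primesM.
have lognMl x y p : (0 < x)%N -> (0 < y)%N -> coprime x y ->
    p \in primes x -> logn p (x * y) = logn p x.
  move=> x_gt0 y_gt0 co_xy; rewrite mem_primes => /and3P[_ _ p_x].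
  by rewrite lognM // (logn_coprime (coprime_dvdl p_x co_xy)) addn0.
rewrite /moebius (perm_all _ primes_ab) (perm_size primes_ab) all_cat size_cat.
rewrite (@eq_in_all _ _ (fun p => logn p a == 1%N) (primes a)); last first.
  by move=> p p_a; rewrite lognMl.
rewrite (@eq_in_all _ _ (fun p => logn p b == 1%N) (primes b)); last first.
  by move=> p p_b; rewrite mulnC lognMl // coprime_sym.
by case: ifP => [/andP[-> ->]|]; rewrite ?exprD //; do 2!case: all;
  rewrite ?mulr0 ?mul0r.
Qed.

(** * Ramanujan sums *)

Section RamanujanSum.
Variable F : numFieldType.

(** Hölder's closed form of the sum of the [n]-th powers of the primitive
    [k]-th roots of unity. *)
Definition ramanujan (n k : nat) : F :=
  (moebius (k %/ gcdn n k))%:~R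
  * ((totient k)%:R / (totient (k %/ gcdn n k))%:R).

Lemma ramanujanM n a b : (0 < a)%N -> (0 < b)%N -> coprime a b ->
  ramanujan n (a * b) = ramanujan n a * ramanujan n b.
Proof.
move=> a_gt0 b_gt0 co_ab; rewrite /ramanujan gcdnM_coprime //.
rewrite divnMA -divn_mulAC ?dvdn_gcdr // -muln_divA ?dvdn_gcdr //.
set a' := (a %/ _)%N; set b' := (b %/ _)%N.
have a'_a : (a' %| a)%N by rewrite dvdn_div ?dvdn_gcdr.
have b'_b : (b' %| b)%N by rewrite dvdn_div ?dvdn_gcdr.
have co_ab' : coprime a' b' by apply: coprime_dvdl a'_a (coprime_dvdr b'_b _).
rewrite moebiusM ?(dvdn_gt0 _ a'_a) ?(dvdn_gt0 _ b'_b) //.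
by rewrite !totient_coprime // !natrM intrM invfM; ring.
Qed.

(** The argument of [moebius] and of the second [totient] is [p ^ (i - v)] with
    truncated subtraction and [v = logn p n], whence the three cases
    [i - v = 0], [1] and more. *)
Lemma ramanujan_pfactor n p i : prime p -> (0 < n)%N ->
  ramanujan n (p ^ i) =
    if (i <= logn p n)%N then (totient (p ^ i))%:R
    else if i == (logn p n).+1 then - (p ^ logn p n)%:R else 0.
Proof.
move=> p_pr n_gt0; have [m co_pm def_n] := pfactor_coprime p_pr n_gt0.
have p_gt0 := prime_gt0 p_pr; rewrite /ramanujan.
set v := logn p n in def_n *.
have gcdE : gcdn n (p ^ i) = (p ^ minn i v)%N.
  by rewrite def_n gcdnC Gauss_gcdr ?coprimeXl // expn_min.
have -> : (p ^ i %/ gcdn n (p ^ i) = p ^ (i - v))%N.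
  by rewrite gcdE -expnB ?geq_minl // minnE subKn ?leq_subr.
have [le_iv|lt_vi] := leqP i v.
  by rewrite (eqP le_iv) mul1r divr1.
have [->|neq_iv] := eqVneq i v.+1.
  rewrite subSnn expn1 moebius_prime // (totient_prime p_pr) totient_pfactor //=.
  rewrite natrM mulrAC mulfV ?pnatr_eq0 -?lt0n; last first.
    by rewrite -subn1 subn_gt0 prime_gt1.
  by rewrite mul1r mulN1r.
rewrite moebius_pfactor_gt1 ?mul0r //.
by rewrite ltn_subRL addn1 ltn_neqAle eq_sym neq_iv.
Qed.

(** As [totient (p ^ i) = p ^ i - p ^ (i - 1)], the sum telescopes to [p ^ e]
    until the first negative term, which cancels it. *)
Lemma sum_ramanujan_pfactor n p e : prime p -> (0 < n)%N ->
  \sum_(0 <= i < e.+1) ramanujan n (p ^ i)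
    = if (e <= logn p n)%N then (p ^ e)%:R else 0.
Proof.
move=> p_pr n_gt0; elim: e => [|e IHe].
  by rewrite big_nat1 ramanujan_pfactor.
rewrite big_nat_recr //= IHe ramanujan_pfactor // eqSS.
case: (ltngtP e (logn p n)) => [_|_|->]; rewrite ?addr0 ?subrr //.
rewrite totient_pfactor //= expnS -natrD; congr _%:R.
by rewrite -mulSn prednK ?prime_gt0.
Qed.

(** The orthogonality relation of Ramanujan sums. The right-hand side is
    multiplicative in [m] too, since coprime [a] and [b] satisfy
    [a * b %| n] if and only if both divide [n]. *)
Lemma sum_divisors_ramanujan n m : (0 < n)%N -> (0 < m)%N ->
  \sum_(k <- divisors m) ramanujan n k = if (m %| n)%N then m%:R else 0.
Proof.
move=> n_gt0; move: m; apply: nat_coprime_ind => [p e p_pr|a b a_gt0 b_gt0].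
  rewrite (perm_big _ (divisors_pfactor e p_pr)) big_map.
  by rewrite sum_ramanujan_pfactor // pfactor_dvdn.
move=> co_ab IHa IHb; rewrite (perm_big _ (divisorsM a_gt0 b_gt0 co_ab)).
rewrite big_allpairs_dep /= Gauss_dvd //.
transitivity ((\sum_(x <- divisors a) ramanujan n x)
              * \sum_(y <- divisors b) ramanujan n y).
  rewrite mulr_suml; apply: eq_big_seq => x; rewrite -dvdn_divisors // => x_a.
  rewrite mulr_sumr; apply: eq_big_seq => y; rewrite -dvdn_divisors // => y_b.
  rewrite ramanujanM ?(dvdn_gt0 _ x_a) ?(dvdn_gt0 _ y_b) //.
  exact: coprime_dvdl x_a (coprime_dvdr y_b co_ab).
by rewrite IHa IHb natrM; do 2!case: dvdn; rewrite ?mulr0 ?mul0r.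
Qed.

End RamanujanSum.

(** * The expansion of a divisor sum *)

Theorem mainTheorem1 (R : realType) (g f : nat -> R[i])
    (hf : forall n : nat, (0 < n)%N -> f n = \sum_(d <- divisors n) g d) :
  forall n : nat, (0 < n)%N ->
    f n = \sum_(1 <= k < n.+1)
            (moebius (k %/ gcdn n k))%:~R
            * ((totient k)%:R / (totient (k %/ gcdn n k))%:R)
            * \sum_(1 <= l < (n %/ k).+1) g (k * l)%N / (k * l)%:R.
Proof.
move=> n n_gt0; rewrite hf // (sum_divisorsE g n_gt0 (leqnn n)).
transitivity (\sum_(1 <= k < n.+1) \sum_(1 <= m < n.+1 | (k %| m)%N)
                ramanujan R[i] n k * (g m / m%:R)); last first.
  apply: eq_big_nat => k /andP[k_gt0 _]; rewrite -mulr_sumr.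
  by rewrite -(sum_multiplesE n (fun m => g m / m%:R) k_gt0).
rewrite (exchange_big_dep xpredT) //= big_mkcond /=.
apply: eq_big_nat => m /andP[m_gt0 le_mn].
rewrite -mulr_suml -(sum_divisorsE (ramanujan _ n) m_gt0 le_mn).
rewrite sum_divisors_ramanujan //; case: dvdn; last by rewrite mul0r.
by rewrite mulrC divfK // pnatr_eq0 -lt0n.
Qed.
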